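(* Let $\ell\in\mathbb N$ and, for $1\le k\le\ell$, let $\mathbf X_k=(X_{k,1},\ldots,X_{k,n_k})$ and $\mathbf Y_k=(Y_{k,1},\ldots,Y_{k,m_k})$ be tuples of self-adjoint operators ($n_k,m_k\ge0$, $n_k+m_k\ge1$) in a C$^*$-non-commutative probability space $(\mathcal A,\varphi)$ such that all the $X_{k,i}$ (left) and all the $Y_{k,j}$ (right) together form a tracially bi-partite system; write $\mathbf Z_k=\mathbf X_k\sqcup\mathbf Y_k$. For $M,d\in\mathbb N$, $\epsilon>0$ and $R\in(0,\infty]$ let \begin{align*} &\tilde\chi_{\mathrm{orb},R}(\mathbf Z_1,\ldots,\mathbf Z_\ell;M,d,\epsilon)\\ &=\sup_{((\mathbf A_k)_k,(\mathbf B_k)_k)\in\left(\prod_{k=1}^\ell(\mathcal M_d^{sa})_R^{n_k}\right)\times\left(\prod_{k=1}^\ell(\mathcal M_d^{sa})_R^{m_k}\right)}\log\Big(\gamma_d^{\otimes\ell}\big(\Gamma_{\mathrm{orb}}(\mathbf Z_1,\ldots,\mathbf Z_\ell:(\mathbf A_k)_{k=1}^\ell,(\mathbf B_k)_{k=1}^\ell;M,d,\epsilon)\big)\Big)\\ &=\sup_{(\mathbf A_k,\mathbf B_k)\in\Gamma_R(\mathbf X_k\sqcup\mathbf Y_k;M,d,\epsilon),\ 1\le k\le\ell}\log\Big(\gamma_d^{\otimes\ell}\big(\Gamma_{\mathrm{orb}}(\mathbf Z_1,\ldots,\mathbf Z_\ell:(\mathbf A_k)_{k=1}^\ell,(\mathbf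 B_k)_{k=1}^\ell;M,d,\epsilon)\big)\Big) \end{align*} (the two suprema being equal), an element of $[-\infty,0]$. Then \[ \chi_{\mathrm{orb},R}(\mathbf Z_1,\ldots,\mathbf Z_\ell)=\inf_{M\in\mathbb N,\epsilon>0}\limsup_{d\to\infty}\frac1{d^2}\tilde\chi_{\mathrm{orb},R}(\mathbf Z_1,\ldots,\mathbf Z_\ell;M,d,\epsilon). \]
   Context: A C$^*$-non-commutative probability space $(\mathcal A,\varphi)$ is a unital C$^*$-algebra with a state $\varphi$. A tracially bi-partite system $(\{X_i\}_{i=1}^n,\{Y_j\}_{j=1}^m)$ in $(\mathcal A,\varphi)$ consists of self-adjoint operators $X_1,\ldots,X_n$ (left variables) and $Y_1,\ldots,Y_m$ (right variables) in $\mathcal A$ such that every $X_i$ commutes with every $Y_j$ (in distribution: interchanging adjacent $X_i,Y_j$ in a word does not change $\varphi$ of the word) and $\varphi$ is tracial on the unital algebra generated by the $X_i$ and on the unital algebra generated by the $Y_j$. Microstates. $\mathcal M_d$ is the algebra of complex $d\times d$ matrices, $\mathcal M_d^{sa}$ its self-adjoint part, $(\mathcal M_d^{sa})_R$ the elements of $\mathcal M_d^{sa}$ of operator norm at most $R$ (all of $\mathcal M_d^{sa}$ if $R=\infty$), $\tau_d$ the normalized trace. For $M,d\in\mathbb N$, $\epsilon>0$ and $R\in(0,\infty]$, $\Gamma_R(X_1,\ldots,X_n\sqcup Y_1,\ldots,Y_m;M,d,\epsilon)$ is the set of $(A_1,\ldots,A_n,B_1,\ldots,B_m)\in((\mathcal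 M_d^{sa})_R)^{n+m}$ with \[ |\varphi(X_{i_1}\cdots X_{i_p}Y_{j_1}\cdots Y_{j_q})-\tau_d(A_{i_1}\cdots A_{i_p}B_{j_q}\cdots B_{j_1})|<\epsilon \] for all $p,q\ge0$ with $1\le p+q\le M$ and all indices. In $\Gamma_R(\mathbf X_1,\ldots,\mathbf X_\ell\sqcup\mathbf Y_1,\ldots,\mathbf Y_\ell;M,d,\epsilon)$ the left variables are those in $\mathbf X_1,\ldots,\mathbf X_\ell$ and the right variables those in $\mathbf Y_1,\ldots,\mathbf Y_\ell$, in the order listed. Orbital bi-free entropy. Let $U(d)$ be the unitary group of $\mathcal M_d$ with normalized Haar measure $\gamma_d$, and $E_d=\prod_{k=1}^\ell(\mathcal M_d^{sa})^{n_k}\times\prod_{k=1}^\ell(\mathcal M_d^{sa})^{m_k}$. Define $\Phi_d:U(d)^\ell\times E_d\to E_d$ by $\Phi_d((U_k)_k,(\mathbf A_k)_k,(\mathbf B_k)_k)=((U_k^*\mathbf A_kU_k)_k,(U_k^*\mathbf B_kU_k)_k)$, where conjugation is applied entrywise. For a regular Borel probability measure $\mu$ on $E_d$ put $\chi_{\mathrm{orb},R}(\mathbf Z_1,\ldots,\mathbf Z_\ell;M,d,\epsilon;\mu)=\log\big((\gamma_d^{\otimes\ell}\otimes\mu)(\Phi_d^{-1}(\Gamma_R(\mathbf X_1,\ldots,\mathbf X_\ell\sqcup\mathbf Y_1,\ldots,\mathbf Y_\ell;M,d,\epsilon)))\big)$; let $\chi_{\mathrm{orb},R}(\cdot;M,d,\epsilon)$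 be the supremum over all such $\mu$; $\chi_{\mathrm{orb},R}(\cdot;M,\epsilon)=\limsup_{d\to\infty}\frac1{d^2}\chi_{\mathrm{orb},R}(\cdot;M,d,\epsilon)$; and $\chi_{\mathrm{orb},R}(\cdot)=\inf_{M\in\mathbb N,\epsilon>0}\chi_{\mathrm{orb},R}(\cdot;M,\epsilon)$. For $((\mathbf A_k)_k,(\mathbf B_k)_k)\in E_d$, $\Gamma_{\mathrm{orb}}(\mathbf Z_1,\ldots,\mathbf Z_\ell:(\mathbf A_k)_{k=1}^\ell,(\mathbf B_k)_{k=1}^\ell;M,d,\epsilon)$ is the set of $(U_k)_{k=1}^\ell\in U(d)^\ell$ with $\Phi_d((U_k)_k,(\mathbf A_k)_k,(\mathbf B_k)_k)\in\Gamma_\infty(\mathbf X_1,\ldots,\mathbf X_\ell\sqcup\mathbf Y_1,\ldots,\mathbf Y_\ell;M,d,\epsilon)$. Conventions: $\log0=-\infty$ and $\sup\emptyset=-\infty$. *)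

(* Defs.v *)
From HB Require Import structures.
From mathcomp Require Import all_boot all_order all_algebra.
From mathcomp Require Import complex.
From mathcomp Require Import all_classical all_reals all_analysis.
Set Implicit Arguments.
Unset Strict Implicit.
Unset Printing Implicit Defensive.
Import Order.TTheory GRing.Theory Num.Theory.
Import numFieldNormedType.Exports.
Local Open Scope classical_set_scope.
Local Open Scope ring_scope.
Local Open Scope sesquilinear_scope.

Definition cmod (R : realType) (z : R[i]) : R := complex.Re `|z|.

HB.mixin Record isCStar (R : realType) A of GRing.Algebra R[i] A := {
  star : A -> A;
  cnorm : A -> R;
  starK : forall x : A, star (star x) = x;
  starD : forall x y : A, star (x + y) = star x + star y;
  starZ : forall (c : R[i]) (x : A), star (c *: x) = c^* *: star x;
  starM : forall x y : A, star (x * y) = star y * star x;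
  cnorm0_eq0 : forall x : A, cnorm x = 0 -> x = 0;
  cnormD : forall x y : A, cnorm (x + y) <= cnorm x + cnorm y;
  cnormZ : forall (c : R[i]) (x : A), cnorm (c *: x) = cmod c * cnorm x;
  cnormM : forall x y : A, cnorm (x * y) <= cnorm x * cnorm y;
  cnorm_star : forall x : A, cnorm (star x * x) = cnorm x ^+ 2;
  cnorm_complete : forall u : nat -> A,
    (forall e : R, 0 < e -> exists N : nat,
       forall p q : nat, (N <= p)%N -> (N <= q)%N -> cnorm (u p - u q) < e) ->
    exists l : A, cnorm (u p - l) @[p --> \oo] --> (0 : R)
}.

#[short(type="cstarType")]
HB.structure Definition CStar (R : realType) :=
  { A of isCStar R A & GRing.Algebra R[i] A }.

Definition is_state (R : realType) (A : cstarType R) (phi : A -> R[i]) : Prop :=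
  [/\ forall (c : R[i]) (x y : A), phi (c *: x + y) = c * phi x + phi y,
      forall x : A, 0 <= phi (star x * x)
    & phi 1 = 1].

Definition unital_subalgebra (R : realType) (A : cstarType R) (B : set A)
  : Prop :=
  [/\ B 1, forall (c : R[i]) x y, B x -> B y -> B (c *: x + y)
    & forall x y, B x -> B y -> B (x * y)].

Definition gen_algebra (R : realType) (A : cstarType R) (S : set A) : set A :=
  smallest (@unital_subalgebra R A) S.

(* Left and right variables commute in distribution: the word w below is a word
   in all the variables, [inl i] standing for X i and [inr j] for Y j. *)
Definition tracially_bipartite (R : realType) (A : cstarType R)
    (phi : A -> R[i]) (I J : finType) (X : I -> A) (Y : J -> A) : Prop :=
  let word (w : seq (I + J)) :=
    \prod_(c <- w) (match c with inl i => X i | inr j => Y j end) in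
  [/\ forall i, star (X i) = X i,
      forall j, star (Y j) = Y j,
      forall (w1 w2 : seq (I + J)) (i : I) (j : J),
        phi (word w1 * X i * Y j * word w2) =
        phi (word w1 * Y j * X i * word w2),
      {in gen_algebra (range X) &, forall a b, phi (a * b) = phi (b * a)}
    & {in gen_algebra (range Y) &, forall a b, phi (a * b) = phi (b * a)}].

(* The topology of R[i] is the one induced by its modulus. *)
HB.instance Definition _ (R : realType) :=
  PseudoPointedMetric.copy R[i] (Num.ClosedField.sort R[i]).

Section Matrices.
Context (R : realType) (d : nat).

Definition l2norm (v : 'cV[R[i]]_d) : R :=
  Num.sqrt (\sum_(i < d) cmod (v i ord0) ^+ 2).

Definition opnorm (M : 'M[R[i]]_d) : R :=
  sup [set l2norm (M *m v) | v in [set v | l2norm v <= 1]].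

Definition ntrace (M : 'M[R[i]]_d) : R[i] := d%:R^-1 * \tr M.

Definition selfadjoint_set : set 'M[R[i]]_d := [set M | M ^t* = M].

Definition unitary_set : set 'M[R[i]]_d := [set U | U \is unitarymx].

Definition saMatrix : Type := set_type selfadjoint_set.
Definition unitaryGroup : Type := set_type unitary_set.

HB.instance Definition _ := Topological.on saMatrix.
HB.instance Definition _ := Topological.on unitaryGroup.

Lemma selfadjoint0 : selfadjoint_set 0.
Proof. by apply/matrixP => i j; rewrite !mxE conjC0. Qed.

Lemma unitary1 : unitary_set 1%:M.
Proof. by apply/unitarymxP; rewrite trmx1 map_mx1 mulmx1. Qed.

HB.instance Definition _ :=
  isPointed.Build saMatrix (SigSub (mem_set selfadjoint0)).
HB.instance Definition _ :=
  isPointed.Build unitaryGroup (SigSub (mem_set unitary1)).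

Definition saval (M : saMatrix) : 'M[R[i]]_d := set_val M.
Definition uval (U : unitaryGroup) : 'M[R[i]]_d := set_val U.

Lemma unitary_setM (U V : unitaryGroup) : unitary_set (uval U *m uval V).
Proof. exact: mul_unitarymx (set_valP U) (set_valP V). Qed.

Definition unitary_mul (U V : unitaryGroup) : unitaryGroup :=
  SigSub (mem_set (unitary_setM U V)).

Lemma selfadjoint_conj (U : unitaryGroup) (M : saMatrix) :
  selfadjoint_set ((uval U) ^t* *m saval M *m uval U).
Proof.
rewrite /selfadjoint_set /= !trmx_mul !map_mxM trmxCK.
by rewrite (set_valP M : _ ^t* = _) mulmxA.
Qed.

(* U^* M U *)
Definition sa_conj (U : unitaryGroup) (M : saMatrix) : saMatrix :=
  SigSub (mem_set (selfadjoint_conj U M)).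

End Matrices.

Definition borel (T : ptopologicalType) : Type :=
  g_sigma_algebraType (@open T).
HB.instance Definition _ (T : ptopologicalType) := Measurable.on (borel T).

(* On a compact group a left-invariant Borel probability measure is the
   normalized Haar measure; on the metrizable compact group U(d) such a measure
   is automatically regular. *)
Definition is_haar (R : realType) (d : nat)
    (gamma : probability (borel (unitaryGroup R d)) R) : Prop :=
  forall (U : unitaryGroup R d) (S : set (borel (unitaryGroup R d))),
    measurable S -> gamma (unitary_mul U @` S) = gamma S.

Definition is_regular (R : realType) (T : ptopologicalType)
    (mu : probability (borel T) R) : Prop :=
  forall S : set (borel T), measurable S ->
    mu S = ereal_inf [set mu O | O in [set O : set T | open O /\ S `<=` O]] /\
    mu S = ereal_sup [set mu K | K in [set K : set T | compact K /\ K `<=` S]].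

(* The powers of gamma live on the product sigma-algebra; since U(d) is second
   countable this is the Borel sigma-algebra of U(d)^n. *)
Section ProductPower.
Context (R : realType) (dsp : measure_display) (T : measurableType dsp).

Definition tuple_cons n (x : T * n.-tuple T) : n.+1.-tuple T :=
  [tuple of x.1 :: x.2].

Lemma measurable_tuple_cons n : measurable_fun setT (@tuple_cons n).
Proof. by apply: measurable_cons. Qed.

HB.instance Definition _ n :=
  isMeasurableFun.Build _ _ _ _ (@tuple_cons n) (@measurable_tuple_cons n).

Fixpoint prob_power (gamma : probability T R) n : probability (n.-tuple T) R :=
  match n with
  | 0 => \d_([tuple] : 0.-tuple T)
  | n'.+1 => distribution (gamma \x prob_power gamma n')%E (@tuple_cons n')
  end.

Lemma measurable_box n (S : 'I_n -> set T) : (forall i, measurable (S i)) ->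
  measurable [set t : n.-tuple T | forall i, S i (tnth t i)].
Proof.
move=> mS; rewrite (_ : [set t | _] =
    ~` \big[setU/set0]_(i < n) ((fun t : n.-tuple T => tnth t i) @^-1` ~` S i)).
  apply: measurableC; apply: bigsetU_measurable => i _.
  rewrite -[X in measurable X]setTI.
  exact: (measurable_tnth i measurableT (measurableC (mS i))).
apply/seteqP; split => [t St|t nSt i].
  apply: (big_ind (fun B : set _ => ~ B t)) => [//|B C|i _]; last exact.
  by move=> nBt nCt [].
by apply: contrapT => nSi; apply: nSt; rewrite (bigD1 i)//=; left.
Qed.

Lemma prob_powerE (gamma : probability T R) n (S : 'I_n -> set T) :
  (forall i, measurable (S i)) ->
  prob_power gamma n [set t | forall i, S i (tnth t i)] =
  (\prod_(i < n) gamma (S i))%E.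
Proof.
elim: n S => [|n IH] S mS.
  rewrite big_ord0 /= diracE (_ : [set t | _] = setT) ?in_setT//.
  by apply/seteqP; split => // t _ [].
rewrite big_ord_recl -(IH (fun i => S (lift ord0 i)))//= /distribution.
rewrite /pushforward.
rewrite -(product_measure1E _ _ (mS ord0)
  (measurable_box (fun i => mS (lift ord0 i)))).
congr product_measure1; apply/seteqP; split => [x Sx|[x t] [/= Sx St] i].
  split=> [|i] /=; first exact: (Sx ord0).
  by have := Sx (lift ord0 i); rewrite /tuple_cons tnthS.
by case: (unliftP ord0 i) => [j ->|->]; rewrite /tuple_cons ?tnthS ?tnth0.
Qed.

End ProductPower.

(* The families A_k, for k < l, of n k matrices each are flattened into a single
   family over the disjoint union of the 'I_(n k). *)
Definition block_index (l : nat) (n : 'I_l -> nat) : finType :=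
  {k : 'I_l & 'I_(n k)}.

Definition flatten_family (l : nat) (n : 'I_l -> nat) (T : Type)
    (X : forall k, 'I_(n k) -> T) : block_index n -> T :=
  fun u => X (tag u) (tagged u).

Definition block (l : nat) (n : 'I_l -> nat) (T : Type)
    (X : block_index n -> T) (k : 'I_l) : 'I_(n k) -> T :=
  fun i => X (Tagged (fun k => 'I_(n k)) i).

(* For I = block_index n and J = block_index m this is E_d, the product over k of
   the (M_d^sa)^(n k) times the product over k of the (M_d^sa)^(m k). *)
Definition sa_families (R : realType) (d : nat) (I J : finType) : Type :=
  ({ptws I -> saMatrix R d} * {ptws J -> saMatrix R d})%type.
HB.instance Definition _ R d I J := Topological.on (sa_families R d I J).
HB.instance Definition _ R d I J := Pointed.on (sa_families R d I J).

(* rho = +oo means that there is no cutoff. *)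
Definition microstates (R : realType) (A : cstarType R) (phi : A -> R[i])
    (I J : finType) (X : I -> A) (Y : J -> A)
    (rho : \bar R) (M d : nat) (eps : R) : set (sa_families R d I J) :=
  [set AB |
    [/\ forall i, ((opnorm (saval (AB.1 i)))%:E <= rho)%E,
        forall j, ((opnorm (saval (AB.2 j)))%:E <= rho)%E
      & forall (p : seq I) (q : seq J), (1 <= size p + size q <= M)%N ->
          cmod (phi (\prod_(i <- p) X i * \prod_(j <- q) Y j)
                - ntrace (\prod_(i <- p) saval (AB.1 i) *
                          \prod_(j <- rev q) saval (AB.2 j))) < eps]].
Arguments microstates {R A} phi {I J} X Y rho M d eps.

Section OrbitalEntropy.
Context (R : realType) (A : cstarType R) (phi : A -> R[i]).
Context (l : nat) (n m : 'I_l -> nat).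
Context (X : forall k, 'I_(n k) -> A) (Y : forall k, 'I_(m k) -> A).
Context (gamma : forall d, probability (borel (unitaryGroup R d)) R).
Context (rho : \bar R).

Local Notation E d := (sa_families R d (block_index n) (block_index m)).
Local Notation U d := (borel (unitaryGroup R d)).

Definition orb_action d (x : l.-tuple (U d) * borel (E d)) : E d :=
  (fun u => sa_conj (tnth x.1 (tag u)) (x.2.1 u),
   fun u => sa_conj (tnth x.1 (tag u)) (x.2.2 u)).

Definition joint_microstates (r : \bar R) M d eps : set (E d) :=
  microstates phi (flatten_family X) (flatten_family Y) r M d eps.

Definition chi_orb_mu M d eps (mu : probability (borel (E d)) R) : \bar R :=
  lne ((prob_power (gamma d) l \x mu)%E
         (@orb_action d @^-1` @joint_microstates rho M d eps)).

Definition chi_orb_d M d eps : \bar R :=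
  ereal_sup [set chi_orb_mu M eps mu | mu in
               [set mu : probability (borel (E d)) R | is_regular mu]].

Definition orb_microstates M d eps (AB : E d) : set (l.-tuple (U d)) :=
  [set V | @joint_microstates +oo%E M d eps (orb_action (V, AB))].

Definition chi_orb_at M d eps (AB : E d) : \bar R :=
  lne (prob_power (gamma d) l (orb_microstates M eps AB)).

Definition bounded_families d : set (E d) :=
  [set AB | (forall u, ((opnorm (saval (AB.1 u)))%:E <= rho)%E) /\
            (forall u, ((opnorm (saval (AB.2 u)))%:E <= rho)%E)].

Definition blockwise_microstates M d eps : set (E d) :=
  [set AB | forall k : 'I_l, microstates phi (X (k := k)) (Y (k := k))
              rho M d eps (block AB.1 (k := k), block AB.2 (k := k))].

Definition chi_tilde_d M d eps : \bar R :=
  ereal_sup [set chi_orb_at M eps AB | AB in @bounded_families d].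

Definition chi_tilde_blockwise_d M d eps : \bar R :=
  ereal_sup [set chi_orb_at M eps AB | AB in @blockwise_microstates M d eps].

(* The term d = 0, where d ^- 2 = 0, does not affect the limsup. *)
Definition inf_limsup (f : nat -> nat -> R -> \bar R) : \bar R :=
  ereal_inf [set x | exists (M : nat) (eps : R), [/\ (0 < M)%N, 0 < eps &
    x = limn_esup (fun d => ((d%:R ^- 2)%:E * f M d eps)%E)]].

Definition chi_orb : \bar R := inf_limsup chi_orb_d.

End OrbitalEntropy.
Arguments chi_tilde_d {R A} phi {l n m} X Y gamma rho M d eps.
Arguments chi_tilde_blockwise_d {R A} phi {l n m} X Y gamma rho M d eps.
Arguments chi_orb {R A} phi {l n m} X Y gamma rho.

(* Main.v *)
Require Import Defs.
From HB Require Import structures.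
From mathcomp Require Import all_boot all_order all_algebra.
From mathcomp Require Import complex.
From mathcomp Require Import all_classical all_reals all_analysis.
From mathcomp Require Import measurable_realfun.
Set Implicit Arguments.
Unset Strict Implicit.
Unset Printing Implicit Defensive.
Import Order.TTheory GRing.Theory Num.Theory.
Import numFieldNormedType.Exports.
Local Open Scope classical_set_scope.
Local Open Scope ring_scope.
Local Open Scope sesquilinear_scope.

(** For every fixed M, d and eps the quantity chi_orb_d already equals
    chi_tilde_d.  Conjugation by unitaries preserves the operator norm, so the
    section over (A, B) of the preimage of the microstates under the action is
    the orbital microstate set of (A, B) when all the entries have norm at most
    rho, and is empty otherwise.  By Fubini the measure of the preimage is the
    mu-average of the measures of these sections, hence at most their supremum,
    and the Dirac measures recover each single section.
    Passing to block-wise microstates loses nothing: conjugation of a block by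
    one unitary preserves the trace of each word in that block, so a family with
    a nonempty orbital microstate set consists of block-wise microstates. *)

(** * Complex modulus and Euclidean norm *)

Lemma cmod_sqr (R : realType) (z : R[i]) :
  cmod z ^+ 2 = complex.Re z ^+ 2 + complex.Im z ^+ 2.
Proof. by rewrite /cmod normc_def /= sqr_sqrtr ?addr_ge0 ?sqr_ge0. Qed.

Lemma cmod_ge0 (R : realType) (z : R[i]) : 0 <= cmod z.
Proof. by rewrite /cmod normc_def /= sqrtr_ge0. Qed.

Lemma cmodM (R : realType) (z w : R[i]) : cmod (z * w) = cmod z * cmod w.
Proof. by rewrite /cmod normrM !normc_def /= !(mulr0, mul0r) subr0. Qed.

Lemma cmod_sum (R : realType) (I : Type) (s : seq I) (f : I -> R[i]) :
  cmod (\sum_(i <- s) f i) <= \sum_(i <- s) cmod (f i).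
Proof.
elim: s => [|i s IH]; first by rewrite !big_nil /cmod normr0.
by rewrite !big_cons (le_trans (le_normcD _ _))// lerD2l.
Qed.

Lemma l2norm_sqr (R : realType) d (v : 'cV[R[i]]_d) :
  l2norm v ^+ 2 = \sum_i cmod (v i ord0) ^+ 2.
Proof. by rewrite sqr_sqrtr// sumr_ge0// => i _; rewrite sqr_ge0. Qed.

(** * Algebras of real functions and matrices with entries in them *)

(* P is instantiated both by the continuous functions on E_d and by the functions
   measurable for the product sigma-algebra on U(d)^l * E_d, which is not a priori
   a Borel sigma-algebra. *)
Section FunctionAlgebras.
Context (R : realType) (T : Type) (P : set (T -> R)).

(** Negation is multiplication by the constant -1, so these closure properties reach every real
    polynomial expression. *)
Definition function_algebra : Prop :=
  [/\ forall c, P (cst c), forall f g, P f -> P g -> P (f \+ g)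
    & forall f g, P f -> P g -> P (f \* g)].

(** Passing to real and imaginary parts makes complex arithmetic, conjugation included, polynomial
    over [R]. *)
Definition complex_in (f : T -> R[i]) : Prop :=
  P (fun t => complex.Re (f t)) /\ P (fun t => complex.Im (f t)).

Definition matrix_in p q (F : T -> 'M[R[i]]_(p, q)) : Prop :=
  forall i j, complex_in (fun t => F t i j).

Hypothesis algP : function_algebra.

Lemma function_algebraN f : P f -> P (\- f).
Proof.
case: algP => PC PD PM Pf; rewrite (_ : \- f = cst (-1) \* f); first exact: PM.
by apply/funext => t /=; rewrite mulN1r.
Qed.

Lemma function_algebra_sum (I : Type) (s : seq I) (f : I -> T -> R) :
  (forall i, P (f i)) -> P (fun t => \sum_(i <- s) f i t).
Proof.
case: algP => PC PD PM Pf; elim: s => [|i s IH].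
  by rewrite (_ : (fun _ => _) = cst 0) //; apply/funext => t; rewrite big_nil.
rewrite (_ : (fun _ => _) = f i \+ (fun t => \sum_(i <- s) f i t)).
  exact: PD.
by apply/funext => t; rewrite big_cons.
Qed.

Lemma complex_in_cst c : complex_in (cst c).
Proof. by case: algP => PC _ _; split; apply: PC. Qed.

Lemma complex_inD f g :
  complex_in f -> complex_in g -> complex_in (fun t => f t + g t).
Proof.
case: algP => _ PD _ [fR fI] [gR gI].
split; [have := PD _ _ fR gR | have := PD _ _ fI gI]; congr P;
  by apply/funext => t /=; case: (f t) (g t) => ? ? [].
Qed.

Lemma complex_inM f g :
  complex_in f -> complex_in g -> complex_in (fun t => f t * g t).
Proof.
case: algP => _ PD PM [fR fI] [gR gI]; split.
  have := PD _ _ (PM _ _ fR gR) (function_algebraN (PM _ _ fI gI)); congr P.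
  by apply/funext => t /=; case: (f t) (g t) => ? ? [].
have := PD _ _ (PM _ _ fR gI) (PM _ _ fI gR); congr P.
by apply/funext => t /=; case: (f t) (g t) => ? ? [].
Qed.

Lemma complex_inB f g :
  complex_in f -> complex_in g -> complex_in (fun t => f t - g t).
Proof.
move=> fP gP; have := complex_inD fP (complex_inM (complex_in_cst (-1)) gP).
by congr complex_in; apply/funext => t /=; rewrite mulN1r.
Qed.

Lemma complex_in_conj f : complex_in f -> complex_in (fun t => (f t) ^*).
Proof.
case=> fR fI; split; [have := fR | have := function_algebraN fI]; congr P;
  by apply/funext => t /=; case: (f t).
Qed.

Lemma complex_in_sum (I : Type) (s : seq I) (f : I -> T -> R[i]) :
  (forall i, complex_in (f i)) -> complex_in (fun t => \sum_(i <- s) f i t).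
Proof.
move=> fP; elim: s => [|i s IH].
  rewrite (_ : (fun _ => _) = cst 0); first exact: complex_in_cst.
  by apply/funext => t; rewrite big_nil.
rewrite (_ : (fun _ => _) = fun t => f i t + \sum_(i <- s) f i t).
  exact: complex_inD.
by apply/funext => t; rewrite big_cons.
Qed.

(** The square is a polynomial in the two parts, whereas the modulus itself is not; its square root
    is taken later, by composition. *)
Lemma cmod_sqr_in f : complex_in f -> P (fun t => cmod (f t) ^+ 2).
Proof.
case: algP => _ PD PM [fR fI].
have := PD _ _ (PM _ _ fR fR) (PM _ _ fI fI); congr P.
by apply/funext => t; rewrite cmod_sqr !expr2.
Qed.

Lemma matrix_in_cst p q (M : 'M[R[i]]_(p, q)) : matrix_in (cst M).
Proof. by move=> i j; apply: complex_in_cst. Qed.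

Lemma matrix_inM p q r (F : T -> 'M[R[i]]_(p, q)) (G : T -> 'M[R[i]]_(q, r)) :
  matrix_in F -> matrix_in G -> matrix_in (fun t => F t *m G t).
Proof.
move=> FP GP i j.
rewrite (_ : (fun _ => _) = fun t => \sum_k F t i k * G t k j).
  by apply: complex_in_sum => k; apply: complex_inM.
by apply/funext => t; rewrite mxE.
Qed.

Lemma matrix_in_adj p q (F : T -> 'M[R[i]]_(p, q)) :
  matrix_in F -> matrix_in (fun t => (F t) ^t*).
Proof.
move=> FP i j; rewrite (_ : (fun _ => _) = fun t => (F t j i) ^*).
  exact: complex_in_conj.
by apply/funext => t; rewrite !mxE.
Qed.

Lemma matrix_in_prod d (I : Type) (s : seq I) (F : I -> T -> 'M[R[i]]_d) :
  (forall i, matrix_in (F i)) -> matrix_in (fun t => \prod_(i <- s) F i t).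
Proof.
move=> FP; elim: s => [|i s IH].
  rewrite (_ : (fun _ => _) = cst 1); first exact: matrix_in_cst.
  by apply/funext => t; rewrite big_nil.
rewrite (_ : (fun _ => _) = fun t => F i t *m \prod_(i <- s) F i t).
  exact: matrix_inM.
by apply/funext => t; rewrite big_cons.
Qed.

Lemma ntrace_in d (F : T -> 'M[R[i]]_d) :
  matrix_in F -> complex_in (fun t => ntrace (F t)).
Proof.
move=> FP; apply: (complex_inM (complex_in_cst _)).
by apply: complex_in_sum.
Qed.

Lemma l2norm_sqr_in d (F : T -> 'cV[R[i]]_d) :
  matrix_in F -> P (fun t => l2norm (F t) ^+ 2).
Proof.
move=> FP; under eq_fun do rewrite l2norm_sqr.
by apply: function_algebra_sum => i; apply: cmod_sqr_in.
Qed.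

End FunctionAlgebras.

(** * Measurable and continuous functions as instances *)

Lemma measurable_function_algebra (R : realType) d (T : measurableType d) :
  function_algebra (fun f : T -> R => measurable_fun setT f).
Proof.
split; [exact: measurable_cst | exact: measurable_funD |].
exact: measurable_funM.
Qed.

Lemma continuous_function_algebra (R : realType) (T : topologicalType) :
  function_algebra (fun f : T -> R => continuous f).
Proof.
split=> [c|f g fc gc|f g fc gc] t; first exact: cvg_cst.
  by apply: cvgD; [exact: fc | exact: gc].
by apply: cvgM; [exact: fc | exact: gc].
Qed.

(** Open intervals generate the sigma-algebra of [R], and their preimages are open, hence generators
    of [borel T]. *)
Lemma continuous_measurable (R : realType) (T : ptopologicalType) (f : T -> R) :
  continuous f -> measurable_fun [set: borel T] f.
Proof.
move=> /continuousP cf; apply: (measurability _ (RGenOpens.measurableE R)).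
move=> _ [_ [a [b ->] <-]]; rewrite setTI; apply: sub_sigma_algebra.
exact/cf/interval_open.
Qed.

Lemma Re_continuous (R : realType) : continuous (@complex.Re R).
Proof.
move=> z S /= /nbhs_ballP [e e0 eS]; apply/nbhs_ballP.
(* Radii of balls in [R[i]] are themselves complex, so the real radius [e] is embedded. *)
exists (e%:C)%C; first by rewrite /= ltcR.
move=> w; rewrite /ball/= normc_def ltcR => zw; apply: eS.
rewrite /ball/=; apply: le_lt_trans zw.
rewrite -sqrtr_sqr ler_wsqrtr//; case: z w => a b [u v] /=.
by rewrite lerDl sqr_ge0.
Qed.

Lemma Im_continuous (R : realType) : continuous (@complex.Im R).
Proof.
move=> z S /= /nbhs_ballP [e e0 eS]; apply/nbhs_ballP.
exists (e%:C)%C; first by rewrite /= ltcR.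
move=> w; rewrite /ball/= normc_def ltcR => zw; apply: eS.
rewrite /ball/=; apply: le_lt_trans zw.
rewrite -sqrtr_sqr ler_wsqrtr//; case: z w => a b [u v] /=.
by rewrite lerDr sqr_ge0.
Qed.

Lemma entry_continuous (R : numDomainType) (T : pseudoPMetricType R) p q i j :
  continuous (fun M : 'M[T]_(p, q) => M i j).
Proof.
move=> M S /= /nbhs_ballP [e e0 eS].
by apply/nbhs_ballP; exists e => // N [_ MN]; apply/eS/MN.
Qed.

Lemma continuous_matrix_in (R : realType) (T : topologicalType) p q
    (F : T -> 'M[R[i]]_(p, q)) :
  continuous F -> matrix_in (fun f : T -> R => continuous f) F.
Proof.
move=> Fc i j.
have Fijc : continuous (fun t => F t i j).
  move=> t; have /= := @entry_continuous _ R[i] p q i j (F t).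
  exact: (@continuous_comp _ _ _ F (fun M : 'M[R[i]]_(p, q) => M i j) t (Fc t)).
split=> t.
  exact: (continuous_comp (Fijc t) (@Re_continuous R _)).
exact: (continuous_comp (Fijc t) (@Im_continuous R _)).
Qed.

Lemma matrix_in_subset (R : realType) (T : Type) (P Q : set (T -> R)) p q
    (F : T -> 'M[R[i]]_(p, q)) : P `<=` Q -> matrix_in P F -> matrix_in Q F.
Proof. by move=> PQ PF i j; have [PR PI] := PF i j; split; apply: PQ. Qed.

Lemma matrix_in_measurable_comp (R : realType) d d' (S : measurableType d)
    (T : measurableType d') p q (F : T -> 'M[R[i]]_(p, q)) (g : S -> T) :
  measurable_fun setT g ->
  matrix_in (fun f : T -> R => measurable_fun setT f) F ->
  matrix_in (fun f : S -> R => measurable_fun setT f) (F \o g).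
Proof.
move=> mg mF i j; have [mR mI] := mF i j; split;
  [exact: (measurableT_comp mR mg) | exact: (measurableT_comp mI mg)].
Qed.

(** * Continuity of the matrices of a family, and closed points of E_d *)

Lemma uval_continuous (R : realType) d : continuous (@uval R d).
Proof. exact: initial_continuous. Qed.

Lemma uval_unitary (R : realType) d (U : unitaryGroup R d) :
  uval U \is unitarymx.
Proof. exact: (set_valP U). Qed.

Lemma saval_continuous (R : realType) d : continuous (@saval R d).
Proof. exact: initial_continuous. Qed.

Section Families.
Context (R : realType) (d : nat) (I J : finType).
Local Notation E := (sa_families R d I J).

Lemma left_continuous u : continuous (fun AB : E => saval (AB.1 u)).
Proof.
have cfst : continuous (fun AB : E => AB.1) by move=> AB; exact: cvg_fst.
have cu : continuous (fun AB : E => AB.1 u).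
  move=> AB; have /= cp := @proj_continuous I (fun=> saMatrix R d) u AB.1.
  exact: (continuous_comp (cfst AB) cp).
by move=> AB; exact: (continuous_comp (cu AB) (@saval_continuous R d _)).
Qed.

Lemma right_continuous u : continuous (fun AB : E => saval (AB.2 u)).
Proof.
have csnd : continuous (fun AB : E => AB.2) by move=> AB; exact: cvg_snd.
have cu : continuous (fun AB : E => AB.2 u).
  move=> AB; have /= cp := @proj_continuous J (fun=> saMatrix R d) u AB.2.
  exact: (continuous_comp (csnd AB) cp).
by move=> AB; exact: (continuous_comp (cu AB) (@saval_continuous R d _)).
Qed.

Lemma saval_inj : injective (@saval R d).
Proof. exact: val_inj. Qed.

(** A point is a finite intersection of closed fibres of continuous real functions, the real and
    imaginary parts of all matrix entries. This serves the regularity of Dirac measures. *)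
Lemma closed_singleton (AB : E) : closed [set AB].
Proof.
have closed_fiber c (f : E -> R) : continuous f -> closed [set x | f x = c].
  by move=> /continuous_closedP/(_ _ (@closed_eq R c)).
have closed_eq (F : E -> 'M[R[i]]_d) : continuous F ->
    closed [set x | F x = F AB].
  move=> /continuous_matrix_in Fc.
  rewrite (_ : [set x | _] = \bigcap_(ij in [set: 'I_d * 'I_d])
    ([set x | complex.Re (F x ij.1 ij.2) = complex.Re (F AB ij.1 ij.2)] `&`
     [set x | complex.Im (F x ij.1 ij.2) = complex.Im (F AB ij.1 ij.2)])).
    apply: closed_bigI => -[i j] _ /=; have [cR cI] := Fc i j.
    exact: closedI (closed_fiber _ _ cR) (closed_fiber _ _ cI).
  apply/seteqP; split=> [x /= Fx [i j] _|x Fx]; first by rewrite /= Fx.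
  apply/matrixP => i j; have [/= FR FI] := Fx (i, j) Logic.I.
  by apply/eqP; rewrite eq_complex FR FI !eqxx.
rewrite (_ : [set AB] =
  (\bigcap_(u in [set: I]) [set x : E | saval (x.1 u) = saval (AB.1 u)]) `&`
  (\bigcap_(u in [set: J]) [set x : E | saval (x.2 u) = saval (AB.2 u)])).
  apply: closedI; apply: closed_bigI => u _; apply: closed_eq.
    exact: left_continuous.
  exact: right_continuous.
apply/seteqP; split=> [x /= -> //|x /= [x1 x2]].
rewrite [x]surjective_pairing [AB]surjective_pairing.
congr pair; apply/funext => u; apply: saval_inj; [exact: x1 | exact: x2].
Qed.

End Families.

(** * Operator norm: unitary invariance and closed sublevel sets *)

Section OperatorNorm.
Context (R : realType) (d : nat).
Implicit Types (A : 'M[R[i]]_d) (v : 'cV[R[i]]_d).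

(** With the squared norm in the form v^* v, unitary invariance becomes a matrix computation. *)
Lemma l2norm_dot v : (l2norm v ^+ 2)%:C%C = (v ^t* *m v) ord0 ord0.
Proof.
rewrite l2norm_sqr mxE rmorph_sum; apply: eq_bigr => i _.
by rewrite !mxE mulrC -normCK -add_Re2_Im2 cmod_sqr.
Qed.

Lemma l2norm_ge0 v : 0 <= l2norm v. Proof. exact: sqrtr_ge0. Qed.

Lemma unitary_adjK (U : 'M[R[i]]_d) : U \is unitarymx -> U ^t* *m U = 1%:M.
Proof. by move=> /unitarymxP UU; apply: mulmx1C. Qed.

Lemma l2norm_unitary (U : 'M[R[i]]_d) v :
  U \is unitarymx -> l2norm (U *m v) = l2norm v.
Proof.
move=> Uu; apply/eqP; rewrite -(@eqrXn2 _ 2) ?l2norm_ge0//; apply/eqP.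
apply: complexI; rewrite !l2norm_dot trmx_mul map_mxM mulmxA -(mulmxA (v ^t*)).
rewrite (unitary_adjK Uu) mulmx1; reflexivity.
Qed.

(** U maps the unit ball onto itself and U^* preserves norms, so both suprema run over the same set
    of numbers. *)
Lemma opnorm_conj (U : 'M[R[i]]_d) A :
  U \is unitarymx -> opnorm (U ^t* *m A *m U) = opnorm A.
Proof.
move=> Uu; congr sup; have Uu' : U ^t* \is unitarymx by rewrite trmxC_unitary.
apply/seteqP; split=> [_ [v v1 <-]|_ [v v1 <-]].
  exists (U *m v); first by rewrite /= l2norm_unitary.
  by rewrite -!mulmxA [RHS](l2norm_unitary _ Uu').
exists (U ^t* *m v); first by rewrite /= l2norm_unitary.
rewrite -!mulmxA (mulmxA U) (unitarymxP Uu) mul1mx.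
exact: l2norm_unitary Uu'.
Qed.

(** Any bound uniform in [v] would do: it makes the supremum defining [opnorm] a genuine least upper
    bound. This one uses that the entries of [v] have modulus at most 1. *)
Lemma l2norm_mulmx_bounded A v : l2norm v <= 1 ->
  l2norm (A *m v) <= Num.sqrt (\sum_i (\sum_j cmod (A i j)) ^+ 2).
Proof.
move=> v1; have cv j : cmod (v j ord0) <= 1.
  rewrite -(@expr_le1 _ 2)// ?cmod_ge0//.
  have /(le_trans _) : l2norm v ^+ 2 <= 1 by rewrite expr_le1 ?l2norm_ge0.
  apply; rewrite l2norm_sqr (bigD1 j)//= lerDl sumr_ge0// => k _.
  exact: sqr_ge0.
rewrite ler_wsqrtr// ler_sum// => i _.
rewrite lerXn2r ?nnegrE ?cmod_ge0 ?sumr_ge0// => [*|]; first exact: cmod_ge0.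
rewrite mxE; apply: le_trans (cmod_sum _ _) _; apply: ler_sum => j _.
by rewrite cmodM ler_piMr ?cmod_ge0.
Qed.

Lemma opnorm_le A r :
  opnorm A <= r <-> forall v, l2norm v <= 1 -> l2norm (A *m v) <= r.
Proof.
have opP : has_sup [set l2norm (A *m v) | v in [set v | l2norm v <= 1]].
  split; last by exists (Num.sqrt (\sum_i (\sum_j cmod (A i j)) ^+ 2)) =>
    _ [v v1 <-]; exact: l2norm_mulmx_bounded.
  exists (l2norm (A *m 0)); exists 0 => //=.
  have := l2norm_dot 0; rewrite mulmx0 mxE => /complexI/eqP.
  by rewrite sqrf_eq0 => /eqP ->.
split=> [Ar v v1|Ar].
  by apply: le_trans Ar; apply: (sup_upper_bound opP); exists v.
by apply: ge_sup; [exact: opP.1 | move=> _ [v v1 <-]; exact: Ar].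
Qed.

End OperatorNorm.

(** For finite [r], [opnorm_le] presents the sublevel set as an intersection over unit-ball vectors
    of closed conditions. Infinite [r] gives the whole space or the empty set. *)
Lemma closed_opnorm_le (R : realType) (T : topologicalType) d
    (F : T -> 'M[R[i]]_d) (r : \bar R) :
  continuous F -> closed [set t | ((opnorm (F t))%:E <= r)%E].
Proof.
move=> Fc; case: r => [r| |].
- rewrite (_ : [set t | _] =
      \bigcap_(v in [set v : 'cV[R[i]]_d | l2norm v <= 1])
        [set t | l2norm (F t *m v) <= r]); last first.
    by apply/seteqP; split => t; rewrite /= lee_fin opnorm_le.
  apply: closed_bigI => v _.
  have algT := @continuous_function_algebra R T.
  have sc := l2norm_sqr_in algT
    (matrix_inM algT (continuous_matrix_in Fc) (matrix_in_cst algT v)).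
  have lc : continuous (fun t => l2norm (F t *m v)).
    (* The function algebra only yields continuity of the square; the continuous square root
       recovers the norm. *)
    rewrite (_ : (fun _ => _) = fun t => Num.sqrt (l2norm (F t *m v) ^+ 2)).
      move=> t; apply: (continuous_comp (sc t)); exact: sqrt_continuous.
    by apply/funext => t; rewrite sqrtr_sqr ger0_norm ?l2norm_ge0.
  by move/continuous_closedP: lc => /(_ _ (@closed_le R r)).
- rewrite (_ : [set t | _] = setT); first exact: closedT.
  by apply/seteqP; split=> t //= _; exact: leey.
- rewrite (_ : [set t | _] = set0); first exact: closed0.
  by apply/seteqP; split.
Qed.

(** * Measurability of microstate conditions *)

(** Re-indexing by natural numbers through [unpickle], with [setT] at the numbers that encode
    nothing. *)
Lemma measurable_countable_bigcap d (T : measurableType d) (W : countType)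
    (S : W -> set T) :
  (forall w, measurable (S w)) -> measurable (\bigcap_w S w).
Proof.
move=> mS; rewrite (_ : \bigcap_w S w =
    \bigcap_n (if unpickle n is Some w then S w else setT)).
  by apply: bigcapT_measurable => n; case: unpickle.
apply/seteqP; split=> [t St n _|t St w _].
  by case: unpickle => // w; exact: St.
by have := St (pickle w) Logic.I; rewrite pickleK.
Qed.

Section Measurability.
Context (R : realType) (dsp : measure_display) (T : measurableType dsp).
Local Notation meas := (fun f : T -> R => measurable_fun setT f).

Lemma measurable_cmod_lt (f : T -> R[i]) (e : R) :
  complex_in meas f -> measurable [set t | cmod (f t) < e].
Proof.
move=> mf; have alg := @measurable_function_algebra R _ T.
have mc : measurable_fun setT (fun t => cmod (f t)).
  rewrite (_ : (fun _ => _) = Num.sqrt \o (fun t => cmod (f t) ^+ 2)).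
    exact: (measurableT_comp
      (continuous_measurable_fun (@sqrt_continuous R)) (cmod_sqr_in alg mf)).
  by apply/funext => t /=; rewrite sqrtr_sqr ger0_norm ?cmod_ge0.
rewrite (_ : [set t | _] = setT `&` (fun t => cmod (f t)) @^-1` `]-oo, e[).
  exact: mc.
by rewrite setTI; apply/seteqP; split => t /=; rewrite in_itv.
Qed.

(** Without a cutoff only moment conditions remain, one for each of countably many pairs of words,
    and each moment is polynomial in the matrix entries. *)
Lemma measurable_microstates (A : cstarType R) (phi : A -> R[i])
    (I J : finType) (X : I -> A) (Y : J -> A) M d eps
    (F : T -> sa_families R d I J) :
  (forall u, matrix_in meas (fun t => saval ((F t).1 u))) ->
  (forall u, matrix_in meas (fun t => saval ((F t).2 u))) ->
  measurable (F @^-1` microstates phi X Y +oo%E M d eps).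
Proof.
move=> F1 F2; have alg := @measurable_function_algebra R _ T.
(* Pairs of words outside the length range impose nothing, which lets the intersection run over all
   pairs. *)
pose S (w : seq I * seq J) : set T := if (1 <= size w.1 + size w.2 <= M)%N then
  [set t | cmod (phi (\prod_(i <- w.1) X i * \prod_(j <- w.2) Y j)
      - ntrace (\prod_(i <- w.1) saval ((F t).1 i) *
                \prod_(j <- rev w.2) saval ((F t).2 j))) < eps] else setT.
rewrite (_ : _ @^-1` _ = \bigcap_w S w).
  apply: measurable_countable_bigcap => w; rewrite /S; case: ifP => // _.
  apply: measurable_cmod_lt; apply: (complex_inB alg).
    exact: (complex_in_cst alg).
  apply: (ntrace_in alg); apply: (matrix_inM alg);
    exact: (matrix_in_prod alg).
apply/seteqP; split=> [t [_ _ Ft] [p q] _|t St].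
  by rewrite /S /=; case: ifP => // /Ft.
split=> [i|j|p q pq]; rewrite ?leey//.
by have := St (p, q) Logic.I; rewrite /S /= pq.
Qed.

End Measurability.

(** * Microstates under blockwise unitary conjugation *)

Section MicrostateSets.
Context (R : realType) (A : cstarType R) (phi : A -> R[i]).
Context (l : nat) (n m : 'I_l -> nat).
Context (X : forall k, 'I_(n k) -> A) (Y : forall k, 'I_(m k) -> A).
Context (rho : \bar R) (d : nat).
Local Notation E := (sa_families R d (block_index n) (block_index m)).
Local Notation U := (borel (unitaryGroup R d)).
Local Notation act := (@orb_action R l n m d).

(** Entries are measurable on each factor by continuity, then on the product sigma-algebra by
    composing with the projections; conjugation is polynomial in them and their conjugates. *)
Lemma measurable_orb_action_microstates M eps :
  measurable (act @^-1` @joint_microstates R A phi l n m X Y +oo%E M d eps).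
Proof.
have mU k :
  matrix_in (fun f : l.-tuple U * borel E -> R => measurable_fun setT f)
    (fun x => uval (tnth x.1 k)).
  apply: (@matrix_in_measurable_comp _ _ _ _ U _ _ (@uval R d)
    (fun x : l.-tuple U * borel E => tnth x.1 k)).
    exact: (measurableT_comp (measurable_tnth k) measurable_fst).
  apply: matrix_in_subset (continuous_matrix_in (@uval_continuous R d)).
  exact: continuous_measurable.
have mE (F : E -> 'M[R[i]]_d) : continuous F ->
    matrix_in (fun f : l.-tuple U * borel E -> R => measurable_fun setT f)
      (fun x => F x.2).
  move=> /continuous_matrix_in Fc.
  apply: (@matrix_in_measurable_comp _ _ _ _ (borel E) _ _ F
    (fun x : l.-tuple U * borel E => x.2)); first exact: measurable_snd.
  by apply: matrix_in_subset Fc => f; exact: continuous_measurable.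
have alg := @measurable_function_algebra R _ (l.-tuple U * borel E)%type.
apply: measurable_microstates => u /=.
  apply: (matrix_inM alg) (mU _); apply: (matrix_inM alg).
    exact: (matrix_in_adj alg).
  exact: (mE _ (@left_continuous R d _ _ u)).
apply: (matrix_inM alg) (mU _); apply: (matrix_inM alg).
  exact: (matrix_in_adj alg).
exact: (mE _ (@right_continuous R d _ _ u)).
Qed.

Lemma measurable_bounded_families :
  measurable (@bounded_families R l n m rho d : set (borel E)).
Proof.
rewrite -[X in measurable X]setCK; apply: measurableC.
apply: sub_sigma_algebra; apply: closed_openC.
rewrite (_ : @bounded_families R l n m rho d =
    (\bigcap_(u in [set: block_index n])
       [set AB : E | ((opnorm (saval (AB.1 u)))%:E <= rho)%E]) `&`
    (\bigcap_(u in [set: block_index m])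
       [set AB : E | ((opnorm (saval (AB.2 u)))%:E <= rho)%E])).
  apply: closedI; apply: closed_bigI => u _; apply: closed_opnorm_le.
    exact: left_continuous.
  exact: right_continuous.
apply/seteqP; split=> [AB [h1 h2]|AB [h1 h2]].
  by split=> u _; [exact: h1 | exact: h2].
by split=> u; [exact: h1 | exact: h2].
Qed.

Lemma bounded_orb_action V AB :
  @bounded_families R l n m rho d (orb_action (V, AB)) <->
  @bounded_families R l n m rho d AB.
Proof.
have conjE W B : opnorm (@saval R d (sa_conj W B)) = opnorm (saval B).
  exact: opnorm_conj (uval_unitary W).
by split=> -[h1 h2]; split=> u;
  [have := h1 u | have := h2 u | have := h1 u | have := h2 u]; rewrite /= conjE.
Qed.

(** Unitary invariance of the norm moves the cutoff onto (A, B) alone, separating it from the moment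
    conditions. *)
Lemma orb_action_microstatesE M eps :
  act @^-1` @joint_microstates R A phi l n m X Y rho M d eps =
  [set x | @bounded_families R l n m rho d x.2] `&`
  act @^-1` @joint_microstates R A phi l n m X Y +oo%E M d eps.
Proof.
apply/seteqP; split=> -[V AB].
  move=> [h1 h2 h3]; split.
    have bV : @bounded_families R l n m rho d (orb_action (V, AB)).
      split; [exact: h1 | exact: h2].
    exact: ((bounded_orb_action V AB).1 bV).
  by split=> // u; exact: leey.
move=> [bAB [_ _ h3]].
have [h1 h2] := (bounded_orb_action V AB).2 bAB.
by split.
Qed.

Lemma ntrace_conj (V : 'M[R[i]]_d) (B : 'M[R[i]]_d) : V \is unitarymx ->
  ntrace (V ^t* *m B *m V) = ntrace B.
Proof.
by move=> Vu; rewrite /ntrace mxtrace_mulC mulmxA (unitarymxP Vu) mul1mx.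
Qed.

Lemma mul_conj (V B C : 'M[R[i]]_d) : V \is unitarymx ->
  (V ^t* *m B *m V) *m (V ^t* *m C *m V) = V ^t* *m (B *m C) *m V.
Proof.
move=> Vu; rewrite !mulmxA -(mulmxA _ V (V ^t*)) (unitarymxP Vu) mulmx1.
reflexivity.
Qed.

Lemma prod_conj (V : 'M[R[i]]_d) (I : Type) (s : seq I) (B : I -> 'M[R[i]]_d) :
  V \is unitarymx ->
  \prod_(i <- s) (V ^t* *m B i *m V) = V ^t* *m (\prod_(i <- s) B i) *m V.
Proof.
move=> Vu; elim: s => [|i s IH].
  (* The empty word requires V^* V = 1, while the cancellations between letters use V V^* = 1. *)
  by rewrite !big_nil mulmx1 unitary_adjK.
by rewrite !big_cons IH; exact: mul_conj.
Qed.

(** A word in the variables of block [k] involves only the unitary V_k, which telescopes out of the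
    product and disappears under the trace. *)
Lemma orb_microstates_blockwise M eps V AB :
  @bounded_families R l n m rho d AB ->
  @orb_microstates R A phi l n m X Y M d eps AB V ->
  @blockwise_microstates R A phi l n m X Y rho M d eps AB.
Proof.
move=> [AB1 AB2] [_ _ ABV] k; split=> [i|j|p q pq]; [exact: AB1 | exact: AB2 |].
(* The words of block [k] are read as words of the joint family, with unchanged length. *)
pose tn := map (fun i => Tagged (fun k => 'I_(n k)) i : block_index n) p.
pose tm := map (fun j => Tagged (fun k => 'I_(m k)) j : block_index m) q.
have := ABV tn tm; rewrite !size_map -map_rev !big_map => /(_ pq) /=.
have Vu := uval_unitary (tnth V k).
rewrite !(prod_conj _ _ Vu) -mulmxE (mul_conj _ _ Vu) (ntrace_conj _ Vu).
exact.
Qed.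

End MicrostateSets.

(** * Fubini for sections, and regularity of Dirac measures *)

(** By uniqueness the product measure agrees with the one that integrates sections over the second
    factor; here that factor will carry [mu]. *)
Lemma product_measure_ysection (R : realType) d1 d2 (T1 : measurableType d1)
    (T2 : measurableType d2) (m1 : probability T1 R) (m2 : probability T2 R)
    (S : set (T1 * T2)) : measurable S ->
  ((m1 \x m2) S = \int[m2]_y m1 (ysection S y))%E.
Proof.
move=> mS; rewrite (@product_measure_unique _ _ _ _ _ m1 m2
  (product_measure2 m1 m2))// => A B mA mB.
exact: product_measure2E.
Qed.

(** If [a] lies in [S], the whole space and the compact set {a} attain the two extrema; otherwise
    the open complement of {a} and the empty set do. *)
Lemma dirac_regular (R : realType) (T : ptopologicalType) (a : T) :
  closed [set a] -> is_regular (\d_(a : borel T) : probability (borel T) R).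
Proof.
move=> cl_a S mS.
have dE (B : set (borel T)) :
  (\d_(a : borel T) : probability (borel T) R) B = ((a : borel T) \in B)%:R%:E.
  exact: diracE.
rewrite !dE; have [aS|aS] := pselect (S a).
  rewrite mem_set//; split; apply/eqP; rewrite eq_le; apply/andP; split.
  - apply: le_ereal_inf_tmp => _ [G [_ SG] <-].
    by rewrite dE mem_set//; exact: SG.
  - apply: ereal_inf_lbound; exists setT; first by split => //; exact: openT.
    by rewrite dE in_setT.
  - apply: ereal_sup_ubound; exists [set a].
      by split; [exact: compact_set1 | move=> _ ->].
    by rewrite dE mem_set.
  - apply: ge_ereal_sup => _ [K [_ KS] <-].
    by rewrite dE lee_fin; case: (_ \in K).
rewrite memNset//; split; apply/eqP; rewrite eq_le; apply/andP; split.
- apply: le_ereal_inf_tmp => _ [G _ <-].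
  by rewrite dE lee_fin.
- apply: ereal_inf_lbound; exists (~` [set a]).
    by split; [exact: closed_openC | move=> x Sx /= xa; apply: aS; rewrite -xa].
  by rewrite dE memNset// => /(_ erefl).
- apply: ereal_sup_ubound; exists set0; first by split; [exact: compact0|].
  by rewrite dE in_set0.
- apply: ge_ereal_sup => _ [K [_ KS] <-].
  by rewrite dE memNset// => /KS.
Qed.

(** * Equality of the entropies at fixed [M], [d] and [eps] *)

Section OrbitalEntropyEquality.
Context (R : realType)
  (gamma : forall d : nat, probability (borel (unitaryGroup R d)) R).
Context (A : cstarType R) (phi : A -> R[i]) (l : nat) (n m : 'I_l -> nat).
Context (X : forall k : 'I_l, 'I_(n k) -> A).
Context (Y : forall k : 'I_l, 'I_(m k) -> A).
Context (rho : \bar R) (M d : nat) (eps : R).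
Local Notation E := (sa_families R d (block_index n) (block_index m)).
Local Notation bounded := (@bounded_families R l n m rho d).
Local Notation orbital := (@orb_microstates R A phi l n m X Y M d eps).

Lemma ysection_orb_action_microstates (AB : E) :
  ysection (@orb_action R l n m d @^-1`
    @joint_microstates R A phi l n m X Y rho M d eps) AB =
  if `[< bounded AB >] then orbital AB else set0.
Proof.
rewrite orb_action_microstatesE; apply/seteqP; split=> [V|V].
  by rewrite /ysection /= inE => -[/= bAB]; case: asboolP.
by rewrite /ysection /= inE; case: asboolP.
Qed.

(** Taking the section of the preimage without cutoff covers every [AB], bounded or not. *)
Lemma measurable_orb_microstates (AB : E) : measurable (orbital AB).
Proof.
rewrite (_ : orbital AB = ysection (@orb_action R l n m d @^-1`
    @joint_microstates R A phi l n m X Y +oo%E M d eps) AB).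
  exact: (@measurable_ysection _ _ _ (borel E) _ _
    (measurable_orb_action_microstates phi X Y M eps)).
by apply/seteqP; split=> V; rewrite /ysection /= inE.
Qed.

Lemma chi_orb_at_le0 (AB : E) :
  (@chi_orb_at R A phi l n m X Y gamma M d eps AB <= 0)%E.
Proof.
rewrite /chi_orb_at lne_le0; apply: probability_le1.
exact: measurable_orb_microstates.
Qed.

Lemma measurable_orb_action_microstates_bounded :
  measurable (@orb_action R l n m d @^-1`
    @joint_microstates R A phi l n m X Y rho M d eps :
      set (l.-tuple (borel (unitaryGroup R d)) * borel E)).
Proof.
rewrite orb_action_microstatesE; apply: measurableI.
  rewrite -[X in measurable X]setTI.
  exact: (@measurable_snd _ _ _ (borel E) _ _
    (@measurable_bounded_families _ _ _ _ rho d)).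
exact: measurable_orb_action_microstates.
Qed.

Lemma chi_tilde_blockwise_dE :
  chi_tilde_d phi X Y gamma rho M d eps =
  chi_tilde_blockwise_d phi X Y gamma rho M d eps.
Proof.
apply/eqP; rewrite eq_le; apply/andP; split.
  apply: ge_ereal_sup => _ [AB bAB <-].
  (* An empty orbital set contributes log 0 = -oo; otherwise any [V] in it shows that [AB] is
     blockwise admissible. *)
  have [AB0|/set0P[V ABV]] := eqVneq (orbital AB) set0.
    by rewrite /chi_orb_at AB0 measure0 le0_lneNy// leNye.
  apply: ereal_sup_ubound; exists AB => //.
  exact: orb_microstates_blockwise bAB ABV.
apply: ereal_sup_le => _ [AB bAB <-]; exists AB => //.
by split=> -[k i]; have [h1 h2 _] := bAB k; [exact: h1 | exact: h2].
Qed.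

Lemma chi_orb_dE :
  @chi_orb_d R A phi l n m X Y gamma rho M d eps =
  chi_tilde_d phi X Y gamma rho M d eps.
Proof.
have mS := measurable_orb_action_microstates_bounded.
apply/eqP; rewrite eq_le; apply/andP; split.
  apply: ge_ereal_sup => _ [mu _ <-]; rewrite /chi_orb_mu.
  (* Exponentiating turns the claim into a bound on the [mu]-average of the section measures. *)
  rewrite product_measure_ysection// -lee_expeR lneK; last first.
    by rewrite in_itv /= leey andbT integral_ge0.
  set s := chi_tilde_d _ _ _ _ _ _ _ _.
  (* Since [mu] has total mass 1, the bound is the integral of a constant, and it suffices to
     compare integrands. *)
  have -> : expeR s = (\int[mu]_y (cst (expeR s) y))%E.
    by rewrite integral_cst// [X in (_ * X)%E]probability_setT mule1.
  apply: ge0_le_integral => //.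
  - exact: measurable_fun_ysection.
  - move=> AB _; rewrite ysection_orb_action_microstates /=.
    (* A bounded [AB] competes in the supremum [s]; any other has an empty section. *)
    case: asboolP => [bAB|_]; last by rewrite measure0 expeR_ge0.
    rewrite -[leLHS]lneK ?in_itv/= ?measure_ge0 ?leey// lee_expeR.
    by apply: ereal_sup_ubound; exists AB.
apply: ge_ereal_sup => _ [AB bAB <-].
have AB_regular := dirac_regular R (@closed_singleton R d _ _ AB).
(* The Dirac measure at [AB] collapses the average to the single section over [AB]. *)
apply: ereal_sup_ubound; exists (\d_(AB : borel E)) => //.
rewrite /chi_orb_mu product_measure_ysection// integral_dirac//; last first.
  exact: measurable_fun_ysection.
by rewrite diracT mul1e ysection_orb_action_microstates asboolT.
Qed.

End OrbitalEntropyEquality.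

Theorem proposition5p4 (R : realType)
  (gamma : forall d : nat, probability (borel (unitaryGroup R d)) R)
  (gammaP : forall d : nat, is_haar (gamma d))
  (A : cstarType R) (phi : A -> R[i]) (phiP : is_state phi)
  (l : nat) (l_gt0 : (0 < l)%N) (n m : 'I_l -> nat)
  (nm_gt0 : forall k : 'I_l, (1 <= n k + m k)%N)
  (X : forall k : 'I_l, 'I_(n k) -> A) (Y : forall k : 'I_l, 'I_(m k) -> A)
  (XYP : tracially_bipartite phi (flatten_family X) (flatten_family Y))
  (rho : \bar R) (rho_gt0 : (0 < rho)%E) :
  (forall (M d : nat) (eps : R), (0 < M)%N -> (0 < d)%N -> 0 < eps ->
     chi_tilde_d phi X Y gamma rho M d eps =
       chi_tilde_blockwise_d phi X Y gamma rho M d eps /\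
     (chi_tilde_d phi X Y gamma rho M d eps <= 0)%E) /\
  chi_orb phi X Y gamma rho =
    inf_limsup (chi_tilde_d phi X Y gamma rho).
Proof.
split=> [M d eps _ _ _|].
  split; first exact: chi_tilde_blockwise_dE.
  by apply: ge_ereal_sup => _ [AB _ <-]; exact: chi_orb_at_le0.
(* The two functions agree at all arguments, including d = 0, so the limsup and the infimum stay
   closed. *)
congr inf_limsup; apply/funext => M; apply/funext => d; apply/funext => eps.
exact: chi_orb_dE.
Qed.
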